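(* Suppose $E:\mathcal{P}_{2,\omega_0}(\mathbb{R}^d)\to\mathbb{R}\cup\{+\infty\}$ is proper, coercive, lower semicontinuous and $\lambda$-convex along generalized geodesics for some $\lambda\in\mathbb{R}$. Let $\mu\in\overline{D(E)}$ and $0<h\le\tau<\frac1{\lambda^-}$, and write $\mu_\tau=J_\tau\mu$. Then for any constant speed $W_2$-geodesic $(\mu_\alpha^{\mu_\tau\to\mu})_{\alpha\in[0,1]}$ from $\mu_\tau$ to $\mu$, $$J_\tau\mu=J_h\big[\mu^{\mu_\tau\to\mu}_{h/\tau}\big].$$
   Context: Fix a probability measure $\omega_0$ on $\mathbb{R}^d$. $W_2$ is the quadratic Wasserstein distance, $\Gamma_0$ the optimal couplings; $\mathcal{P}_{2,\omega_0}(\mathbb{R}^d)=\{\mu:W_2(\mu,\omega_0)<\infty\}$. A curve $u_\alpha$, $\alpha\in[0,1]$, is a constant speed geodesic if $W_2(u_\alpha,u_\beta)=|\beta-\alpha|W_2(u_0,u_1)$ for all $\alpha,\beta$. A transport plan from $\mu_0$ to $\mu_1$ with base $\omega$ is $\boldsymbol\omega\in\mathcal{P}((\mathbb{R}^d)^3)$ with $\pi^{1,2}\#\boldsymbol\omega\in\Gamma_0(\omega,\mu_0)$, $\pi^{1,3}\#\boldsymbol\omega\in\Gamma_0(\omega,\mu_1)$; generalized geodesic $\mu_\alpha=((1-\alpha)\pi^2+\alpha\pi^3)\#\boldsymbol\omega$; $W_{2,\boldsymbol\omega}(\mu_0,\mu_1)=(\int|x_2-x_3|^2d\boldsymbol\omega)^{1/2}$.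 $D(E)=\{E<\infty\}$; proper: $D(E)\ne\emptyset$; coercive: $\exists\tau_0>0,u_0$ with $\inf_v\{\frac1{2\tau_0}W_2^2(u_0,v)+E(v)\}>-\infty$; lower semicontinuous w.r.t. $W_2$; $\lambda$-convex along generalized geodesics: for all $\mu_0,\mu_1,\omega$ there is a generalized geodesic from $\mu_0$ to $\mu_1$ with base $\omega$ (induced by some $\boldsymbol\omega$) with $E(\mu_\alpha)\le(1-\alpha)E(\mu_0)+\alpha E(\mu_1)-\alpha(1-\alpha)\frac\lambda2W^2_{2,\boldsymbol\omega}(\mu_0,\mu_1)$. $\lambda^-=\max\{0,-\lambda\}$, $1/\lambda^-=+\infty$ if $\lambda^-=0$; $\overline{D(E)}$ is the $W_2$-closure. $J_\tau\mu=\operatorname{argmin}_{\nu\in\mathcal{P}_{2,\omega_0}}\{\frac1{2\tau}W_2^2(\mu,\nu)+E(\nu)\}$ (well defined for $\mu\in\overline{D(E)}$, $0<\tau<1/\lambda^-$). *)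

(* Defs.v *)
From HB Require Import structures.
From mathcomp Require Import all_boot all_order all_algebra.
From mathcomp Require Import all_classical all_reals all_analysis.
Set Implicit Arguments. Unset Strict Implicit. Unset Printing Implicit Defensive.
Import Order.TTheory GRing.Theory Num.Theory.
Import numFieldNormedType.Exports.
Local Open Scope classical_set_scope.
Local Open Scope ring_scope.

(* R^d is represented by d.-tuple R, with the product (= Borel) sigma-algebra
   generated by the coordinate projections. *)
Notation Rd R d := (d.-tuple R).

Definition sqdist (R : realType) (d : nat) (x y : Rd R d) : R :=
  \sum_(i < d) (tnth x i - tnth y i) ^+ 2.

Definition meq (R : realType) (d : nat) (mu nu : probability (Rd R d) R) :=
  forall A, measurable A -> mu A = nu A.

Definition coupling (R : realType) (d : nat) (mu nu : probability (Rd R d) R)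
    (gamma : probability (Rd R d * Rd R d)%type R) : Prop :=
  (forall A, measurable A -> pushforward gamma fst A = mu A) /\
  (forall A, measurable A -> pushforward gamma snd A = nu A).

Definition cost (R : realType) (d : nat)
    (gamma : probability (Rd R d * Rd R d)%type R) : \bar R :=
  (\int[gamma]_z (sqdist z.1 z.2)%:E)%E.

Definition W2sq (R : realType) (d : nat) (mu nu : probability (Rd R d) R) : \bar R :=
  ereal_inf [set cost gamma | gamma in [set g | coupling mu nu g]].

Definition W2 (R : realType) (d : nat) (mu nu : probability (Rd R d) R) : \bar R :=
  match W2sq mu nu with
  | r%:E => (Num.sqrt r)%:E
  | +oo%E => +oo%E
  | -oo%E => -oo%E
  end.

Definition optimal_coupling (R : realType) (d : nat) (mu nu : probability (Rd R d) R)
    (gamma : probability (Rd R d * Rd R d)%type R) : Prop :=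
  coupling mu nu gamma /\ cost gamma = W2sq mu nu.

Definition P2 (R : realType) (d : nat) (omega0 mu : probability (Rd R d) R) : Prop :=
  (W2 mu omega0 < +oo)%E.

(* (R^d)^3 is represented as (R^d * R^d) * R^d, z = ((x1, x2), x3). *)
Definition pi12 (R : realType) (d : nat) (z : (Rd R d * Rd R d) * Rd R d) :=
  z.1.
Definition pi13 (R : realType) (d : nat) (z : (Rd R d * Rd R d) * Rd R d) :=
  (z.1.1, z.2).
Definition interp (R : realType) (d : nat) (a : R)
    (z : (Rd R d * Rd R d) * Rd R d) : Rd R d :=
  [tuple (1 - a) * tnth z.1.2 i + a * tnth z.2 i | i < d].

Definition transport_plan_base (R : realType) (d : nat)
    (omega mu0 mu1 : probability (Rd R d) R)
    (bw : probability ((Rd R d * Rd R d) * Rd R d)%type R) : Prop :=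
  (exists g12 : probability (Rd R d * Rd R d)%type R,
      (forall A, measurable A -> g12 A = pushforward bw (@pi12 R d) A) /\
      optimal_coupling omega mu0 g12) /\
  (exists g13 : probability (Rd R d * Rd R d)%type R,
      (forall A, measurable A -> g13 A = pushforward bw (@pi13 R d) A) /\
      optimal_coupling omega mu1 g13).

Definition W2sq_plan (R : realType) (d : nat)
    (bw : probability ((Rd R d * Rd R d) * Rd R d)%type R) : \bar R :=
  (\int[bw]_z (sqdist z.1.2 z.2)%:E)%E.

Section Props.
Context (R : realType) (d : nat) (omega0 : probability (Rd R d) R)
        (E : probability (Rd R d) R -> \bar R).
Local Open Scope ereal_scope.

(* E : P_{2,omega0} -> R u {+oo} *)
Definition no_minus_infty := forall mu, P2 omega0 mu -> E mu != -oo.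

Definition E_proper := exists mu, P2 omega0 mu /\ E mu < +oo.

Definition E_coercive :=
  exists (tau0 : R) (u0 : probability (Rd R d) R),
    (0 < tau0)%R /\ P2 omega0 u0 /\
    exists M : R, forall v, P2 omega0 v ->
      M%:E <= ((2 * tau0)^-1)%:E * W2sq u0 v + E v.

Definition W2_lsc :=
  forall (u_ : nat -> probability (Rd R d) R) (u : probability (Rd R d) R),
    (forall n, P2 omega0 (u_ n)) -> P2 omega0 u ->
    (fun n => W2 (u_ n) u) @ \oo --> 0 ->
    E u <= limn_einf (fun n => E (u_ n)).

Definition convex_gen_geod (lambda : R) :=
  forall mu0 mu1 omega : probability (Rd R d) R,
    P2 omega0 mu0 -> P2 omega0 mu1 -> P2 omega0 omega ->
    exists bw : probability ((Rd R d * Rd R d) * Rd R d)%type R,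
      transport_plan_base omega mu0 mu1 bw /\
      forall (a : R), (0 <= a <= 1)%R ->
        forall mua : probability (Rd R d) R,
          (forall A, measurable A -> mua A = pushforward bw (@interp R d a) A) ->
          E mua <= (1 - a)%:E * E mu0 + a%:E * E mu1
                   - (a * (1 - a) * lambda / 2)%:E * W2sq_plan bw.

Definition in_closure_dom (mu : probability (Rd R d) R) :=
  P2 omega0 mu /\
  forall eps : R, (0 < eps)%R ->
    exists nu, P2 omega0 nu /\ E nu < +oo /\ W2 mu nu < eps%:E.

(* nu is a minimizer of  v |-> W_2^2(mu, v)/(2 tau) + E v  over P_{2,omega0},
   i.e. nu = J_tau mu *)
Definition is_prox (tau : R) (mu nu : probability (Rd R d) R) :=
  P2 omega0 nu /\
  forall v, P2 omega0 v ->
    ((2 * tau)^-1)%:E * W2sq mu nu + E nu <= ((2 * tau)^-1)%:E * W2sq mu v + E v.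

End Props.

Definition const_speed_geodesic (R : realType) (d : nat)
    (u : R -> probability (Rd R d) R) (mu0 mu1 : probability (Rd R d) R) :=
  meq (u 0%R) mu0 /\ meq (u 1%R) mu1 /\
  forall a b : R, (0 <= a <= 1)%R -> (0 <= b <= 1)%R ->
    W2 (u a) (u b) = (`|b - a|%:E * W2 (u 0%R) (u 1%R))%E.

(* Main.v *)
Require Import Defs.
From HB Require Import structures.
From mathcomp Require Import all_boot all_order all_algebra.
From mathcomp Require Import all_classical all_reals all_analysis.
From mathcomp Require Import measurable_realfun ring lra.
Import Order.TTheory GRing.Theory Num.Theory.
Local Open Scope classical_set_scope.
Local Open Scope ring_scope.

(** Put [s = h / tau] and [w = u s], so that [W2 w mu_tau = s W] and
    [W2 w mu = (1 - s) W] with [W = W2 mu_tau mu].  Young's inequality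
    [W2^2 mu v <= W2^2 w mu / (1 - s) + W2^2 w v / s], divided by [2 tau], shows
    that the [h]-functional at [w] exceeds the [tau]-functional at [mu] by at
    least the constant [- (1 - s) W^2 / (2 tau)], with equality at [mu_tau]; so
    [mu_tau] minimizes the former as well.  Young's inequality is integrated
    against the three-marginal plan with base [w] given by the convexity
    hypothesis, once [w] is known to be at finite distance from [omega0].
    Uniqueness holds because the midpoint of the plan joining two minimizers
    lowers the [h]-functional by [(1/h + lambda)/8] times the squared plan
    distance. *)

(** * Laws of measurable maps and the change of variables *)

Section law.
Set Implicit Arguments. Unset Strict Implicit.
Context {R : realType} {d1 d2 : measure_display}.
Context {T : measurableType d1} {T' : measurableType d2}.
Implicit Types (P : probability T R) (Q : probability T' R) (f : T -> T').

Lemma exists_law P f : measurable_fun setT f ->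
  exists Q, forall A, measurable A -> Q A = pushforward P f A.
Proof.
move=> mf.
pose F : {mfun T >-> T'} := HB.pack f (isMeasurableFun.Build _ _ _ _ _ mf).
by exists (distribution P F).
Qed.

Lemma ge0_integral_law P Q f (g : T' -> \bar R) : measurable_fun setT f ->
    (forall A, measurable A -> Q A = pushforward P f A) ->
    measurable_fun setT g -> (forall y, 0 <= g y)%E ->
  (\int[Q]_y g y = \int[P]_x g (f x))%E.
Proof.
move=> mf QE mg g0.
pose F : {mfun T >-> T'} := HB.pack f (isMeasurableFun.Build _ _ _ _ _ mf).
rewrite (eq_measure_integral (distribution P F)); last by move=> A mA _; exact: QE.
by rewrite ge0_integral_distribution.
Qed.

End law.

(** * Gluing two probabilities along a countable label *)

Section gluing.
Set Implicit Arguments. Unset Strict Implicit.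
Context {R : realType} {d1 d2 : measure_display}.
Context {T1 : measurableType d1} {T2 : measurableType d2}.
Local Open Scope ereal_scope.

Lemma measure_fiber_series {d} {T : measurableType d} (P : probability T R)
    (f : T -> nat) A : (forall n, measurable (f @^-1` [set n])) -> measurable A ->
  \sum_(n <oo) P (A `&` f @^-1` [set n]) = P A.
Proof.
move=> mf mA; rewrite -measure_semi_bigcup.
- rewrite -setI_bigcupr; congr (P _); rewrite -[RHS]setIT; congr (_ `&` _).
  by apply/seteqP; split => // x _; exists (f x).
- by move=> n; exact: measurableI.
- apply/trivIsetP => i j _ _ ij; apply/seteqP; split => // x [[_ /= fi] [_ /= fj]].
  by move: ij; rewrite -fi -fj eqxx.
- by apply: bigcup_measurable => n _; exact: measurableI.
Qed.

(* Condition both measures on each common value [n] of the labels, take the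
   product of the conditionals, and average over [n]; at labels of mass zero
   the weight [(m n)^-1] is the junk value [0]. *)
Lemma exists_label_coupling (P1 : probability T1 R) (P2 : probability T2 R)
    (f1 : T1 -> nat) (f2 : T2 -> nat) :
    (forall n, measurable (f1 @^-1` [set n])) ->
    (forall n, measurable (f2 @^-1` [set n])) ->
    (forall n, P1 (f1 @^-1` [set n]) = P2 (f2 @^-1` [set n])) ->
  exists Q : probability (T1 * T2)%type R,
    [/\ forall A, measurable A -> P1 A = pushforward Q fst A,
        forall B, measurable B -> P2 B = pushforward Q snd B &
        {ae Q, forall z, f1 z.1 = f2 z.2}].
Proof.
move=> mf1 mf2 f12.
pose D n := f1 @^-1` [set n] `*` f2 @^-1` [set n].
have mD n : measurable (D n) by exact: measurableX.
pose m n := fine (P1 (f1 @^-1` [set n])).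
have m0 n : (0 <= (m n)^-1)%R by rewrite invr_ge0 fine_ge0.
have mE n : (m n)%:E = P1 (f1 @^-1` [set n]).
  by rewrite fineK// fin_num_measure.
pose Qn n : {measure set (T1 * T2) -> \bar R} :=
  mscale (NngNum (m0 n)) (mrestr (P1 \x P2) (mD n)).
pose Q0 : {measure set (T1 * T2) -> \bar R} := mseries Qn 0.
have Q0X A B : measurable A -> measurable B -> Q0 (A `*` B) =
    \sum_(n <oo) ((m n)^-1)%:E *
      (P1 (A `&` f1 @^-1` [set n]) * P2 (B `&` f2 @^-1` [set n])).
  move=> mA mB; rewrite /Q0 /= /mseries; apply: eq_eseriesr => n _.
  rewrite /Qn/= /mscale/= /mrestr -setXI product_measure1E//; exact: measurableI.
have Q0l A : measurable A -> Q0 (A `*` setT) = P1 A.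
  move=> mA; rewrite Q0X// -(measure_fiber_series P1 mf1)//.
  apply: eq_eseriesr => n _; rewrite setTI -f12 -mE.
  (* At a label of mass zero the left side carries the factor [m n = 0], and the right side is at
     most the mass of a null fibre. *)
  have [mn0|mn0] := eqVneq (m n) 0%R.
    rewrite mn0 mule0 mule0; apply/esym/eqP; rewrite -measure_le0.
    rewrite -[X in _ <= X]/(0%:E) -[in leRHS]mn0 mE.
    by apply: le_measure; rewrite ?inE//; exact: measurableI.
  by rewrite muleC -muleA -EFinM divff// mule1.
have Q0r B : measurable B -> Q0 (setT `*` B) = P2 B.
  move=> mB; rewrite Q0X// -(measure_fiber_series P2 mf2)//.
  apply: eq_eseriesr => n _; rewrite setTI -mE.
  have [mn0|mn0] := eqVneq (m n) 0%R.
    rewrite mn0 mul0e mule0; apply/esym/eqP; rewrite -measure_le0.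
    rewrite -[X in _ <= X]/(0%:E) -[in leRHS]mn0 mE f12.
    by apply: le_measure; rewrite ?inE//; exact: measurableI.
  by rewrite muleA -EFinM mulVf// mul1e.
have Q0T : Q0 setT = 1 by rewrite -setXTT Q0l// probability_setT.
(* [mnormalize] only packages [Q0] as a probability: its total mass is already 1, so the default
   [P1 \x P2] is never taken. *)
pose Q : probability (T1 * T2)%type R := mnormalize Q0 (P1 \x P2).
have QE A : Q A = Q0 A.
  by rewrite /Q/= /mnormalize Q0T onee_eq0/= invr1 mule1.
exists Q; split.
- by move=> A mA; rewrite -Q0l// /pushforward QE; congr (Q0 _);
    apply/seteqP; split=> [[a b] []|[a b]] //=.
- by move=> B mB; rewrite -Q0r// /pushforward QE; congr (Q0 _);
    apply/seteqP; split=> [[a b] []|[a b]] //=.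
(* Each [Qn n] is restricted to [D n], so the complement of the union of the [D n] is null for every
   term of the series. *)
- exists (~` \bigcup_n D n); split.
  + by apply: measurableC; exact: bigcup_measurable.
  + rewrite QE /Q0/= /mseries eseries0// => n _ _.
    rewrite /Qn/= /mscale/= /mrestr (_ : _ `&` _ = set0) ?measure0 ?mule0//.
    by apply/seteqP; split => // z [+ Dz]; apply; exists n.
  + move=> z /= + [n _ [/= z1 z2]]; apply; by rewrite z1 z2.
Qed.

End gluing.

(** * Pointwise inequalities for the squared distance, and unit cubes *)

Section sqdist.
Set Implicit Arguments. Unset Strict Implicit.
Context {R : realType} {d : nat}.
Implicit Types x y z : Rd R d.

Lemma sqdist_ge0 x y : 0 <= sqdist x y.
Proof. by apply: sumr_ge0 => i _; exact: sqr_ge0. Qed.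

Lemma sqdistC x y : sqdist x y = sqdist y x.
Proof. by apply: eq_bigr => i _; ring. Qed.

Lemma sqdist_eq0 x y : sqdist x y = 0 -> x = y.
Proof.
move=> /eqP; rewrite psumr_eq0; last by move=> i _; exact: sqr_ge0.
move=> /allP xy; apply: eq_from_tnth => i.
by have := xy i; rewrite mem_index_enum sqrf_eq0 subr_eq0 => /(_ isT)/eqP.
Qed.

(** The defect is the squared distance from [x] to [s y + (1 - s) z], divided by [s (1 - s)];
    equality thus holds exactly when [x] is that point of the segment. *)
Lemma sqdist_young (s : R) x y z : 0 < s < 1 ->
  sqdist y z <= (1 - s)^-1 * sqdist x y + s^-1 * sqdist x z.
Proof.
move=> /andP[s0 s1]; rewrite /sqdist !mulr_sumr -big_split/=.
apply: ler_sum => i _; set a := tnth x i; set b := tnth y i; set c := tnth z i.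
rewrite -subr_ge0.
have -> : (1 - s)^-1 * (a - b) ^+ 2 + s^-1 * (a - c) ^+ 2 - (b - c) ^+ 2 =
    (s * (1 - s))^-1 * (s * (a - b) + (1 - s) * (a - c)) ^+ 2.
  by field; apply/andP; split; lra.
by rewrite mulr_ge0 ?sqr_ge0// invr_ge0 mulr_ge0//; lra.
Qed.

(** With increments [p], [q], [r] in each coordinate, [3 (p^2 + q^2 + r^2) - (p + q + r)^2] is the
    sum of the squares of the pairwise differences. Three increments are needed because glued
    couplings have two distinct middle points. *)
Lemma sqdist_le3 w x y z :
  sqdist w z <= 3 * (sqdist w x + sqdist x y + sqdist y z).
Proof.
rewrite /sqdist -!big_split mulr_sumr/=; apply: ler_sum => i _.
set a := tnth w i; set b := tnth x i; set c := tnth y i; set e := tnth z i.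
have := sqr_ge0 ((a - b) - (b - c)); have := sqr_ge0 ((b - c) - (c - e)).
have := sqr_ge0 ((a - b) - (c - e)); nra.
Qed.

(** The parallelogram identity; its [1 / 4] term is the source of uniqueness of the minimizer. *)
Lemma sqdist_midpoint x y z :
  sqdist x (interp (1 / 2) ((x, y), z)) + 1 / 4 * sqdist y z =
  1 / 2 * sqdist x y + 1 / 2 * sqdist x z.
Proof.
rewrite /sqdist !mulr_sumr -!big_split/=; apply: eq_bigr => i _.
by rewrite tnth_mktuple /=; field.
Qed.

(** The integer corner of the half-open unit cube containing [x], coded as a natural number to serve
    as a gluing label. *)
Definition cube_label x : nat := pickle [tuple Num.floor (tnth x i) | i < d].

Lemma measurable_cube_label n : measurable (cube_label @^-1` [set n]).
Proof.
(* A number that codes no corner has an empty fibre; otherwise the fibre is a finite intersection of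
   slabs. *)
case E : (pickle_inv n : option (d.-tuple int)) => [t|]; last first.
  rewrite (_ : _ @^-1` _ = set0)//; apply/seteqP; split => // x /= xn.
  by move: E; rewrite -xn /cube_label pickleK_inv.
rewrite (_ : _ @^-1` _ = \bigcap_(i in [set: 'I_d])
    ((fun x => tnth x i) @^-1` `[(tnth t i)%:~R, (tnth t i + 1)%:~R[%classic)).
  apply: fin_bigcap_measurable => // i _; rewrite -[X in measurable X]setTI.
  by apply: measurable_tnth => //; exact: measurable_itv.
apply/seteqP; split => x /= xn.
  move: E; rewrite -xn /cube_label pickleK_inv => -[<-] i _ /=.
  by rewrite tnth_mktuple in_itv/= floor_itv.
have := @pickle_invK (d.-tuple int) n; rewrite E/= => <-; congr pickle.
apply: eq_from_tnth => i; rewrite tnth_mktuple; apply: floor_def.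
by have := xn i I; rewrite /= in_itv.
Qed.

Lemma cube_label_sqdist x y : cube_label x = cube_label y -> sqdist x y <= d%:R.
Proof.
move=> /(pcan_inj pickleK) xy.
rewrite -[d in d%:R]card_ord -sum1_card natr_sum; apply: ler_sum => i _.
have fxy : Num.floor (tnth x i) = Num.floor (tnth y i).
  by have := congr1 (fun t => tnth t i) xy; rewrite !tnth_mktuple.
have /andP[x1 x2] := floor_itv (tnth x i).
have /andP[y1 y2] := floor_itv (tnth y i).
move: x1 x2 y1 y2; rewrite fxy intrD => *.
have [t1 t2] : -1 <= tnth x i - tnth y i /\ tnth x i - tnth y i <= 1 by lra.
nra.
Qed.

Lemma measurable_sqdist {dT} {T : measurableType dT} (f g : T -> Rd R d) :
  measurable_fun setT f -> measurable_fun setT g ->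
  measurable_fun setT (fun t => sqdist (f t) (g t)).
Proof.
move=> mf mg; apply: measurable_sum => i.
apply: measurable_funX; apply: measurable_funB.
  exact: (measurableT_comp (measurable_tnth i) mf).
exact: (measurableT_comp (measurable_tnth i) mg).
Qed.

Lemma measurable_interp (a : R) : measurable_fun setT (@interp R d a).
Proof.
apply/measurable_fun_tnthP => i.
rewrite (_ : _ \o _ = fun z : (Rd R d * Rd R d) * Rd R d =>
    (1 - a) * tnth z.1.2 i + a * tnth z.2 i); last first.
  by apply/funext => z /=; rewrite tnth_mktuple.
apply: measurable_funD; apply: measurable_funM => //.
  apply: (measurableT_comp (measurable_tnth i)).
  exact: (measurableT_comp measurable_snd measurable_fst).
exact: (measurableT_comp (measurable_tnth i) measurable_snd).
Qed.

End sqdist.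

(** * Upper bounds, symmetry and finiteness of the Wasserstein distance *)

Section wasserstein.
Set Implicit Arguments. Unset Strict Implicit.
Context {R : realType} {d : nat}.
Local Notation Rd2 := (Rd R d * Rd R d)%type.
Implicit Types mu nu rho : probability (Rd R d) R.
Local Open Scope ereal_scope.

Lemma ge0_integral_lincomb {dT} {T : measurableType dT} (P : probability T R)
    (f g : T -> R) (a b : R) :
    measurable_fun setT f -> measurable_fun setT g ->
    (forall x, 0 <= f x)%R -> (forall x, 0 <= g x)%R -> (0 <= a)%R -> (0 <= b)%R ->
  \int[P]_x (a * f x + b * g x)%:E =
    a%:E * \int[P]_x (f x)%:E + b%:E * \int[P]_x (g x)%:E.
Proof.
move=> mf mg f0 g0 a0 b0.
have mf' : measurable_fun setT (EFin \o f) by exact/measurable_EFinP.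
have mg' : measurable_fun setT (EFin \o g) by exact/measurable_EFinP.
under eq_integral do rewrite EFinD !EFinM.
rewrite ge0_integralD//.
- by rewrite !ge0_integralZl// => x _; rewrite lee_fin.
- by move=> x _; rewrite -EFinM lee_fin mulr_ge0.
- exact: emeasurable_funM.
- by move=> x _; rewrite -EFinM lee_fin mulr_ge0.
- exact: emeasurable_funM.
Qed.

Lemma cost_ge0 gamma : 0 <= cost (R := R) (d := d) gamma.
Proof. by apply: integral_ge0 => z _; rewrite lee_fin sqdist_ge0. Qed.

Lemma W2sq_ge0 mu nu : 0 <= W2sq mu nu.
Proof. by apply: le_ereal_inf_tmp => _ [g _ <-]; exact: cost_ge0. Qed.

Lemma cost_law {dT} {T : measurableType dT} (P : probability T R)
    (f g : T -> Rd R d) (gamma : probability Rd2 R) :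
    measurable_fun setT f -> measurable_fun setT g ->
    (forall A, measurable A -> gamma A = pushforward P (fun t => (f t, g t)) A) ->
  cost gamma = \int[P]_t (sqdist (f t) (g t))%:E.
Proof.
move=> mf mg gE; rewrite /cost.
rewrite (@ge0_integral_law _ _ _ _ _ P _ (fun t => (f t, g t)))//.
- exact: measurable_fun_pair.
- exact/measurable_EFinP/measurable_sqdist.
- by move=> z; rewrite lee_fin sqdist_ge0.
Qed.

(** The joint law of [(f, g)] is an admissible coupling with this cost. Any common realization of
    two measures therefore bounds their distance from above. *)
Lemma W2sq_le_law {dT} {T : measurableType dT} (P : probability T R)
    (f g : T -> Rd R d) mu nu :
    measurable_fun setT f -> measurable_fun setT g ->
    (forall A, measurable A -> mu A = pushforward P f A) ->
    (forall A, measurable A -> nu A = pushforward P g A) ->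
  W2sq mu nu <= \int[P]_t (sqdist (f t) (g t))%:E.
Proof.
move=> mf mg muE nuE.
have [gamma gE] := exists_law P (measurable_fun_pair mf mg).
rewrite -(cost_law mf mg gE); apply: ereal_inf_lbound; exists gamma => //.
split=> A mA; rewrite /pushforward gE.
- by rewrite muE.
- by rewrite -[X in measurable X]setTI; exact: measurable_fst.
- by rewrite nuE.
- by rewrite -[X in measurable X]setTI; exact: measurable_snd.
Qed.

Lemma W2sq_le_swap mu nu : W2sq nu mu <= W2sq mu nu.
Proof.
apply: le_ereal_inf_tmp => _ [g [g1 g2] <-].
rewrite /cost; under eq_integral do rewrite sqdistC.
by apply: W2sq_le_law => // A mA; rewrite ?g1 ?g2.
Qed.

Lemma W2sqC mu nu : W2sq mu nu = W2sq nu mu.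
Proof. by apply/eqP; rewrite eq_le !W2sq_le_swap. Qed.

Lemma W2sq_meq mu mu' nu nu' : meq mu mu' -> meq nu nu' ->
  W2sq mu nu = W2sq mu' nu'.
Proof.
move=> mumu' nunu'; congr (ereal_inf (_ @` _)); apply/seteqP.
by split=> g [g1 g2]; split=> A mA; rewrite ?g1 ?g2 ?mumu' ?nunu'.
Qed.

Lemma W2sq_lty_coupling mu nu : W2sq mu nu < +oo ->
  exists2 gamma, coupling mu nu gamma & cost gamma < +oo.
Proof. by move=> /ereal_inf_lt [_ [g mg <-] lt]; exists g. Qed.

(* The two couplings are glued only up to the unit cube containing the middle
   point, so that no disintegration is needed. *)
Lemma W2sq_lty_trans nu mu rho :
  W2sq mu nu < +oo -> W2sq nu rho < +oo -> W2sq mu rho < +oo.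
Proof.
move=> /W2sq_lty_coupling[g1 [g11 g12] c1] /W2sq_lty_coupling[g2 [g21 g22] c2].
have mlab (p : Rd2 -> Rd R d) : measurable_fun setT p ->
    forall n, measurable ((cube_label \o p) @^-1` [set n]).
  move=> mp n; rewrite comp_preimage -[X in measurable X]setTI.
  by apply: mp => //; exact: measurable_cube_label.
(* Both labels read the middle point, whose law is [nu] in either coupling, so their fibres have
   equal mass. *)
have [n|Q [Q1 Q2 Qlab]] := exists_label_coupling (P1 := g1) (P2 := g2)
    (mlab _ measurable_snd) (mlab _ measurable_fst).
  have mn := @measurable_cube_label R d n.
  by have := g12 _ mn; rewrite -(g21 _ mn).
have m11 : measurable_fun setT
    (fun z : Rd2 * Rd2 => z.1.1).
  exact: (measurableT_comp measurable_fst measurable_fst).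
have m12 : measurable_fun setT
    (fun z : Rd2 * Rd2 => z.1.2).
  exact: (measurableT_comp measurable_snd measurable_fst).
have m21 : measurable_fun setT
    (fun z : Rd2 * Rd2 => z.2.1).
  exact: (measurableT_comp measurable_fst measurable_snd).
have m22 : measurable_fun setT
    (fun z : Rd2 * Rd2 => z.2.2).
  exact: (measurableT_comp measurable_snd measurable_snd).
have le : W2sq mu rho <= \int[Q]_z (sqdist z.1.1 z.2.2)%:E.
  apply: W2sq_le_law => // A mA.
    rewrite -g11// /pushforward Q1// -[X in measurable X]setTI.
    exact: measurable_fst.
  rewrite -g22// /pushforward Q2// -[X in measurable X]setTI.
  exact: measurable_snd.
apply: (le_lt_trans le).
have c1E : cost g1 = \int[Q]_z (sqdist z.1.1 z.1.2)%:E.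
  apply: cost_law => // A mA; rewrite Q1//.
  by rewrite /pushforward; congr (Q _); apply/seteqP; split=> -[[]].
have c2E : cost g2 = \int[Q]_z (sqdist z.2.1 z.2.2)%:E.
  apply: cost_law => // A mA; rewrite Q2//.
  by rewrite /pushforward; congr (Q _); apply/seteqP; split=> -[? []].
have ms1 := measurable_sqdist m11 m12; have ms2 := measurable_sqdist m21 m22.
(* The bound of [sqdist_le3] with the jump between the two middle points replaced by [d], which is
   legitimate almost everywhere since they share a cube. *)
pose h (z : Rd2 * Rd2) :=
  (3 * (sqdist z.1.1 z.1.2 + sqdist z.2.1 z.2.2) + 3 * d%:R :> R)%R.
have s0 (z : Rd2 * Rd2) : (0 <= sqdist z.1.1 z.1.2 + sqdist z.2.1 z.2.2 :> R)%R.
  by rewrite addr_ge0// sqdist_ge0.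
have ms : measurable_fun setT (fun z : Rd2 * Rd2 =>
  (sqdist z.1.1 z.1.2 + sqdist z.2.1 z.2.2)%R) by exact: measurable_funD.
have mh : measurable_fun setT h.
  by apply: measurable_funD => //; exact: measurable_funM.
apply: (@le_lt_trans _ _ (\int[Q]_z (h z)%:E)).
  apply: ae_ge0_le_integral => //.
  - by move=> z _; rewrite lee_fin sqdist_ge0.
  - exact/measurable_EFinP/measurable_sqdist.
  - by move=> z _; rewrite lee_fin /h addr_ge0 ?mulr_ge0.
  - exact/measurable_EFinP.
  - apply: filterS Qlab => z /cube_label_sqdist le_d _; rewrite lee_fin /h.
    have := sqdist_le3 z.1.1 z.1.2 z.2.1 z.2.2; lra.
rewrite /h (ge0_integral_lincomb Q ms (measurable_cst (d%:R : R)))//.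
under eq_integral do rewrite -[(_ + _)%R]mul1r mulrDr.
rewrite ge0_integral_lincomb ?mul1e//; try by move=> z; exact: sqdist_ge0.
rewrite -c1E -c2E -[X in _ + _ * X]/(\int[Q]_z cst (d%:R)%:E z) integral_cst//.
rewrite [X in _ + _ * (_ * X)](_ : _ = 1) ?mule1; last exact: probability_setT.
have [c10 c20] := (cost_ge0 g1, cost_ge0 g2).
move: c1 c2 c10 c20; case: (cost g1) => // x.
by case: (cost g2) => // y *; rewrite ltry.
Qed.

Lemma W2_ltyE mu nu : (W2 mu nu < +oo) = (W2sq mu nu < +oo).
Proof. by rewrite /W2; case: (W2sq mu nu) => // r; rewrite !ltry. Qed.

Lemma W2sq_fin_num mu nu : W2sq mu nu < +oo -> W2sq mu nu \is a fin_num.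
Proof. by move=> lt; rewrite ge0_fin_numE// W2sq_ge0. Qed.

(** Passes from the constant speed relation, stated for [W2], to squared distances. *)
Lemma W2sq_scale mu nu mu' nu' (s : R) : (0 <= s)%R ->
    W2sq mu' nu' < +oo -> W2 mu nu = s%:E * W2 mu' nu' ->
  W2sq mu nu = (s ^+ 2)%:E * W2sq mu' nu'.
Proof.
move=> s0; rewrite /W2; have := W2sq_ge0 mu' nu'; have := W2sq_ge0 mu nu.
case: (W2sq mu' nu') => // r; case: (W2sq mu nu) => [t| |] //; rewrite !lee_fin.
move=> t0 r0 _; rewrite -EFinM => -[e].
by rewrite -EFinM -(sqr_sqrtr t0) e exprMn sqr_sqrtr.
Qed.

End wasserstein.

(** * Integrated inequalities along a plan with base *)

Section plans.
Set Implicit Arguments. Unset Strict Implicit.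
Context {R : realType} {d : nat}.
Local Notation Rd3 := ((Rd R d * Rd R d) * Rd R d)%type.
Implicit Types (omega mu : probability (Rd R d) R) (bw : probability Rd3 R).
Local Open Scope ereal_scope.

Lemma measurable_plan1 : measurable_fun setT (fun z : Rd3 => z.1.1).
Proof. exact: (measurableT_comp measurable_fst measurable_fst). Qed.

Lemma measurable_plan2 : measurable_fun setT (fun z : Rd3 => z.1.2).
Proof. exact: (measurableT_comp measurable_snd measurable_fst). Qed.

Lemma measurable_plan3 : measurable_fun setT (fun z : Rd3 => z.2).
Proof. exact: measurable_snd. Qed.

Hint Resolve measurable_plan1 measurable_plan2 measurable_plan3 : core.

Lemma transport_plan_laws omega mu0 mu1 bw :
    transport_plan_base omega mu0 mu1 bw ->
  [/\ forall A, measurable A -> omega A = pushforward bw (fun z => z.1.1) A,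
      forall A, measurable A -> mu0 A = pushforward bw (fun z => z.1.2) A &
      forall A, measurable A -> mu1 A = pushforward bw (fun z => z.2) A].
Proof.
have mfst := @measurable_fst _ _ (Rd R d) (Rd R d).
have msnd := @measurable_snd _ _ (Rd R d) (Rd R d).
move=> [[g12 [E12 [[l1 l2] _]]] [g13 [E13 [[l1' l3] _]]]]; split=> A mA.
- by rewrite -l1// /pushforward E12// -[X in measurable X]setTI; exact: mfst.
- by rewrite -l2// /pushforward E12// -[X in measurable X]setTI; exact: msnd.
- by rewrite -l3// /pushforward E13// -[X in measurable X]setTI; exact: msnd.
Qed.

Lemma transport_plan_costs omega mu0 mu1 bw :
    transport_plan_base omega mu0 mu1 bw ->
  \int[bw]_z (sqdist z.1.1 z.1.2)%:E = W2sq omega mu0 /\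
  \int[bw]_z (sqdist z.1.1 z.2)%:E = W2sq omega mu1.
Proof.
move=> [[g12 [E12 [_ <-]]] [g13 [E13 [_ <-]]]].
split; apply/esym/cost_law => // A mA.
rewrite E12// /pushforward (_ : @pi12 R d = fun z => (z.1.1, z.1.2))//.
by apply/funext => -[[]].
Qed.

(** Integrate [sqdist_young]. Optimality of the two marginals containing the base makes the right
    side exact, while the marginal on the last two points is merely a coupling, which suffices for
    an upper bound. *)
Lemma transport_plan_young omega mu0 mu1 bw (s : R) : (0 < s < 1)%R ->
    transport_plan_base omega mu0 mu1 bw ->
  W2sq mu0 mu1 <= (1 - s)^-1%:E * W2sq omega mu0 + s^-1%:E * W2sq omega mu1.
Proof.
move=> s01 tp; have [<- <-] := transport_plan_costs tp.
have [_ l2 l3] := transport_plan_laws tp.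
have /andP[s0 s1] := s01.
have m12 := measurable_sqdist measurable_plan1 measurable_plan2.
have m13 := measurable_sqdist measurable_plan1 measurable_plan3.
have a0 : (0 <= (1 - s)^-1)%R by rewrite invr_ge0; lra.
have b0 : (0 <= s^-1)%R by rewrite invr_ge0; lra.
rewrite -ge0_integral_lincomb//; try by move=> z; exact: sqdist_ge0.
apply: (le_trans (W2sq_le_law measurable_plan2 measurable_plan3 l2 l3)).
apply: ge0_le_integral => //.
- by move=> z _; rewrite lee_fin sqdist_ge0.
- exact/measurable_EFinP/measurable_sqdist.
- by apply/measurable_EFinP/measurable_funD; exact: measurable_funM.
- by move=> z _; rewrite lee_fin sqdist_young.
Qed.

Lemma transport_plan_midpoint omega mu0 mu1 (mid : probability (Rd R d) R) bw :
    transport_plan_base omega mu0 mu1 bw ->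
    (forall A, measurable A -> mid A = pushforward bw (@interp R d (1 / 2)) A) ->
  W2sq omega mid + (1 / 4)%:E * W2sq_plan bw <=
    (1 / 2)%:E * W2sq omega mu0 + (1 / 2)%:E * W2sq omega mu1.
Proof.
move=> tp midE; have [<- <-] := transport_plan_costs tp.
have [l1 _ _] := transport_plan_laws tp.
have mi := @measurable_interp R d (1 / 2).
have m12 := measurable_sqdist measurable_plan1 measurable_plan2.
have m13 := measurable_sqdist measurable_plan1 measurable_plan3.
have m23 := measurable_sqdist measurable_plan2 measurable_plan3.
have m1i := measurable_sqdist measurable_plan1 mi.
rewrite -ge0_integral_lincomb//; try by move=> z; exact: sqdist_ge0.
(* The parallelogram identity is exact; the inequality arises only because the base and the midpoint
   are coupled perhaps not optimally. *)
rewrite [leRHS](eq_integral (fun z : Rd3 =>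
    (1 * sqdist z.1.1 (interp (1 / 2) z) + 1 / 4 * sqdist z.1.2 z.2)%:E)).
  rewrite ge0_integral_lincomb//; try by move=> z; exact: sqdist_ge0.
  by rewrite mul1e leeD2r//; exact: W2sq_le_law.
move=> [[x y] z] _; rewrite [X in _ = (X + _)%:E]mul1r; congr EFin.
by apply/esym; exact: sqdist_midpoint.
Qed.

Lemma le_measure_ae {dT} {T : measurableType dT} (P : probability T R)
    (A B : set T) : measurable A -> measurable B ->
  {ae P, forall x, A x -> B x} -> P A <= P B.
Proof.
move=> mA mB [N [mN PN ABN]].
apply: (@le_trans _ _ (P (B `|` N))).
  apply: le_measure; rewrite ?inE//; first exact: measurableU.
  move=> x Ax; have [Bx|nBx] := pselect (B x); first by left.
  by right; apply: ABN => /= /(_ Ax).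
by rewrite -[leRHS]adde0 -PN; exact: measureU2.
Qed.

(** A vanishing integral forces the last two points to agree almost surely, so their laws
    coincide. *)
Lemma W2sq_plan_eq0 omega mu0 mu1 bw : transport_plan_base omega mu0 mu1 bw ->
  W2sq_plan bw = 0 -> meq mu0 mu1.
Proof.
move=> /transport_plan_laws[_ l2 l3] p0.
have m23 := measurable_sqdist measurable_plan2 measurable_plan3.
have /ae_eq_integral_abs : \int[bw]_z `|(sqdist z.1.2 z.2)%:E| = 0.
  by rewrite -p0; apply: eq_integral => z _; rewrite gee0_abs// lee_fin sqdist_ge0.
move=> /(_ measurableT)[]; first exact/measurable_EFinP.
move=> N HN A mA.
have ae0 : {ae bw, forall z : Rd3, z.1.2 = z.2}.
  by exists N; case: HN => mN N0 sN; split => // z /= nz; apply: sN => /= /(_ I)[]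
   /sqdist_eq0.
rewrite l2// l3// /pushforward.
have mp2 : measurable ((fun z : Rd3 => z.1.2) @^-1` A).
  by rewrite -[X in measurable X]setTI; exact: measurable_plan2.
have mp3 : measurable ((fun z : Rd3 => z.2) @^-1` A).
  by rewrite -[X in measurable X]setTI; exact: measurable_plan3.
apply/eqP; rewrite eq_le !le_measure_ae//; apply: filterS ae0 => z /= ->//.
Qed.

End plans.

(** * Finite energy and uniqueness of minimizers *)

Section prox.
Set Implicit Arguments. Unset Strict Implicit.
Context {R : realType} {d : nat} {omega0 : probability (Rd R d) R}.
Context {E : probability (Rd R d) R -> \bar R}.
Implicit Types mu nu w : probability (Rd R d) R.

Lemma P2_lty mu nu : P2 omega0 mu -> P2 omega0 nu -> (W2sq mu nu < +oo)%E.
Proof.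
rewrite /P2 !W2_ltyE => mu0 nu0; apply: (W2sq_lty_trans mu0).
by rewrite W2sqC.
Qed.

Lemma P2_trans mu nu : P2 omega0 mu -> (W2sq nu mu < +oo)%E -> P2 omega0 nu.
Proof. by rewrite /P2 !W2_ltyE => mu0 numu; exact: (W2sq_lty_trans numu). Qed.

(** Compare with a competitor of finite energy: all distances within [P2] are finite, so the minimal
    value is too. *)
Lemma prox_fin_num tau mu nu : no_minus_infty omega0 E -> E_proper omega0 E ->
  P2 omega0 mu -> is_prox omega0 E tau mu nu -> (E nu \is a fin_num)%E.
Proof.
move=> HE [v [Pv Ev]] Pmu [Pnu /(_ v Pv)].
have := W2sq_fin_num (P2_lty Pmu Pv); have := W2sq_fin_num (P2_lty Pmu Pnu).
move: Ev (HE v Pv) (HE nu Pnu).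
case: (E v) => // e _ _ nuNy; case: (W2sq mu v) => // a; case: (W2sq mu nu) => // b.
by case: (E nu) nuNy.
Qed.

Lemma prox_unique (lambda h : R) w nu1 nu2 :
    no_minus_infty omega0 E -> E_proper omega0 E ->
    convex_gen_geod omega0 E lambda -> P2 omega0 w -> 0 < h -> -1 < h * lambda ->
    is_prox omega0 E h w nu1 -> is_prox omega0 E h w nu2 -> meq nu1 nu2.
Proof.
move=> HE Hp Hconv Pw h0 hl p1 p2.
have f1 := prox_fin_num HE Hp Pw p1; have f2 := prox_fin_num HE Hp Pw p2.
have [P1 min1] := p1; have [P2' min2] := p2.
have [bw [tp cvx]] := Hconv nu1 nu2 w P1 P2' Pw.
apply: (W2sq_plan_eq0 tp).
have [mid midE] := exists_law bw (@measurable_interp R d (1 / 2)).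
have := transport_plan_midpoint tp midE.
have half : (0 <= (1 / 2 : R) <= 1)%R by lra.
have {cvx} := cvx (1 / 2) half mid midE.
have B1 := W2sq_fin_num (P2_lty Pw P1); have B2 := W2sq_fin_num (P2_lty Pw P2').
have p0 : (0 <= W2sq_plan bw)%E.
  by apply: integral_ge0 => z _; rewrite lee_fin sqdist_ge0.
have m0 := W2sq_ge0 w mid.
(* Finiteness of [W2sq w mid] is read off only later from the midpoint inequality, so the facts
   about [mid] stay conditional until then. *)
have Pmid : (W2sq w mid < +oo)%E -> P2 omega0 mid.
  by move=> wm; apply: (P2_trans Pw); rewrite W2sqC.
have HEm Pm := HE mid (Pmid Pm).
have min1m Pm := min1 mid (Pmid Pm).
have {min1} min12 := min1 nu2 P2'.
have {min2} min21 := min2 nu1 P1.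
move: h0 hl f1 f2 B1 B2 p0 m0 HEm min1m min12 min21; clear.
move=> h0 hl; case: (E nu1) => // e1 _; case: (E nu2) => // e2 _.
case: (W2sq w nu1) => // b1 _; case: (W2sq w nu2) => // b2 _.
have quarter : (0 < (1 / 4)%:E :> \bar R)%E by rewrite lte_fin; lra.
(* An infinite plan cost would contradict the finite right side of the midpoint inequality. *)
case: (W2sq_plan bw) => [p| |] //; last first.
  move=> _ m0 _ _ _ _ _.
  by rewrite (gt0_muley quarter) addey -?EFinM -?EFinD ?leye_eq//; case: (W2sq w mid) m0.
case: (W2sq w mid) => [m| |] //.
rewrite ltry !lee_fin => p0 m0 /(_ isT) + /(_ isT).
case: (E mid) => [e| |] // _.
rewrite -?EFinM -?EFinD -?EFinB ?lee_fin.
move=> min1 min2 min3 cvx par; congr EFin.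
have k0 : 0 < (2 * h)^-1 by rewrite invr_gt0 mulr_gt0.
(* The gain at the midpoint per unit of [p]: [1 / 4] comes from the parallelogram identity, scaled
   by [(2 * h)^-1], and [lambda / 8] from convexity at [a = 1 / 2]. *)
have c0 : 0 < (2 * h)^-1 / 4 + lambda / 8.
  rewrite (_ : _ + _ = (1 + h * lambda) / (8 * h)); last by field; rewrite gt_eqF.
  by rewrite divr_gt0 ?mulr_gt0//; lra.
have {}par := ler_wpM2l (ltW k0) par.
(* The midpoint lies below the average of the two minimal values by this amount, yet cannot lie
   below the minimum. *)
have : ((2 * h)^-1 / 4 + lambda / 8) * p <= 0.
  by move: ((2 * h)^-1) min1 min2 min3 par {k0 c0} => k *; lra.
by rewrite pmulr_rle0// => pN; apply/eqP; rewrite eq_le pN.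
Qed.

End prox.

(** * The proximal point seen from the geodesic *)

Theorem theoremA6 (R : realType) (d : nat) (omega0 : probability (d.-tuple R) R)
    (E : probability (d.-tuple R) R -> \bar R) (lambda : R)
    (HE : no_minus_infty omega0 E) (Hprop : E_proper omega0 E)
    (Hcoer : E_coercive omega0 E) (Hlsc : W2_lsc omega0 E)
    (Hconv : convex_gen_geod omega0 E lambda)
    (mu : probability (d.-tuple R) R) (Hmu : in_closure_dom omega0 E mu)
    (h tau : R) (Hh : 0 < h) (Hhtau : h <= tau)
    (Htau : tau * Num.max 0 (- lambda) < 1)
    (mu_tau : probability (d.-tuple R) R) (Hmutau : is_prox omega0 E tau mu mu_tau)
    (u : R -> probability (d.-tuple R) R) (Hu : const_speed_geodesic u mu_tau mu) :
  is_prox omega0 E h (u (h / tau)) mu_tau /\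
  (forall nu, is_prox omega0 E h (u (h / tau)) nu -> meq nu mu_tau).
Proof.
have [Pmu _] := Hmu; have [u0 [u1 geod]] := Hu; have [Pt mint] := Hmutau.
have tau0 : 0 < tau by lra.
pose s := h / tau; rewrite -/s.
have s0 : 0 < s by rewrite divr_gt0.
have s1 : s <= 1 by rewrite ler_pdivrMr// mul1r.
have hE : h = s * tau by rewrite /s divfK// gt_eqF.
have Wfin := P2_lty Pt Pmu.
have u01 : W2sq (u 0) (u 1) = W2sq mu_tau mu := W2sq_meq u0 u1.
have Wt : (W2sq (u s) mu_tau = (s ^+ 2)%:E * W2sq mu_tau mu)%E.
  have mm : meq (u s) (u s) by [].
  rewrite -(W2sq_meq mm u0) -u01; apply: W2sq_scale; rewrite ?u01//; first exact: ltW.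
  by rewrite geod ?lexx ?ler01 ?s1 ?ltW// distrC subr0 gtr0_norm.
have Wm : (W2sq (u s) mu = ((1 - s) ^+ 2)%:E * W2sq mu_tau mu)%E.
  have mm : meq (u s) (u s) by [].
  rewrite -(W2sq_meq mm u1) -u01; apply: W2sq_scale; rewrite ?u01// ?subr_ge0//.
  by rewrite geod ?lexx ?ler01 ?s1 ?ltW// ger0_norm// subr_ge0.
have Pw : P2 omega0 (u s).
  apply: (P2_trans Pt); rewrite Wt; move: (W2sq_fin_num Wfin).
  by case: (W2sq mu_tau mu) => // r _; rewrite -EFinM ltry.
(* Substituting [Wm] cancels the weight [(1 - s)^-1], so the bound also makes sense for [s = 1];
   there [u s] has the law of [mu] and it is an equality. *)
have young v : P2 omega0 v ->
    (W2sq mu v <= (1 - s)%:E * W2sq mu_tau mu + s^-1%:E * W2sq (u s) v)%E.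
  move=> Pv; have [se1|sn1] := eqVneq s 1.
    by rewrite se1 subrr mul0e add0e invr1 mul1e (W2sq_meq u1 (fun _ _ => erefl)).
  have [bw [tp _]] := Hconv mu v (u s) Pmu Pv Pw.
  have s01 : 0 < s < 1 by rewrite s0 lt_neqAle sn1.
  apply: (le_trans (transport_plan_young s01 tp)).
  rewrite Wm muleA -EFinM expr2 mulrA mulVf ?mul1r//.
  by rewrite subr_eq0 eq_sym.
have prox : is_prox omega0 E h (u s) mu_tau.
  split=> // v Pv; have := young v Pv; have := mint v Pv.
  have := prox_fin_num HE Hprop Pmu Hmutau; rewrite Wt W2sqC.
  move: (W2sq_fin_num Wfin) (W2sq_fin_num (P2_lty Pmu Pv)).
  move: (W2sq_fin_num (P2_lty Pw Pv)) (HE v Pv).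
  case: (W2sq (u s) v) => // B _; case: (E v) => [e| |] // _; last first.
    case: (W2sq mu_tau mu) => // W _ _; case: (E mu_tau) => // e0 _ _ _.
    by rewrite -EFinM addey// leey.
  case: (W2sq mu_tau mu) => // W _; case: (W2sq mu v) => // A _.
  case: (E mu_tau) => // e0 _; rewrite -?EFinM -?EFinD ?lee_fin => min yng.
  have k0 : 0 < (2 * tau)^-1 by rewrite invr_gt0 mulr_gt0.
  have {}yng := ler_wpM2l (ltW k0) yng.
  (* In units of [(2 * tau)^-1], minimality leaves [W - (1 - s) W = s W] on the left, which is
     exactly the cost of [mu_tau] from [u s] with step [h]. *)
  have -> : (2 * h)^-1 = (2 * tau)^-1 * s^-1.
    by rewrite hE; field; rewrite !gt_eqF.
  have -> : (2 * tau)^-1 / s * (s ^+ 2 * W) = (2 * tau)^-1 * (s * W).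
    by field; rewrite !gt_eqF.
  move: ((2 * tau)^-1) (s^-1) yng min {k0} => k t yng min; lra.
split=> // nu pnu; apply: (prox_unique HE Hprop Hconv Pw Hh _ pnu prox).
(* With [M] the negative part of [lambda], [h * lambda >= - h * M >= - tau * M > -1]. *)
have := le_max 0 0 (- lambda); have := le_max (- lambda) 0 (- lambda).
rewrite !lexx orbT/=; move: (Num.max _ _) Htau => M Htau lM M0; nra.
Qed.
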